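(* Let $w\in W$ and $\check\eta\in\check R^+(w)$. The following statements are equivalent. (1) $\ell(ws_{\check\eta})=\ell(w)-1$. (2) $\check\eta$ is not decomposable in $\check R^+(w)$. That is, the set $\check R^+_{w,B}=\{\check\eta\in\check R^+(w)\mid\ell(ws_{\check\eta})=\ell(w)-1\}$ is the subset of indecomposable elements in $\check R^+(w)$.
   Context: $W$ is the Weyl group of a simply-connected simple complex algebraic group $G$ (arbitrary Lie type), with a fixed choice of simple reflections, length function $\ell$, and set of positive coroots $\check R^+$. For a coroot $\check\eta$, $s_{\check\eta}\in W$ is the corresponding reflection. For $w\in W$, $\check R^+(w)=\{\check\alpha\in\check R^+\mid w(\check\alpha)<0\}$. An element $\check\eta\in\check R^+(w)$ is called decomposable in $\check R^+(w)$ if $\check\eta=\frac1c(\check\mu+\check\mu')$ for two distinct $\check\mu,\check\mu'\in\check R^+(w)$ and some $c\in\mathbb Z_{>0}$; it is indecomposable if it is not decomposable in $\check R^+(w)$. *)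

(* Defs.v *)
From HB Require Import structures.
From mathcomp Require Import all_boot all_order all_algebra.
From mathcomp Require Import boolp classical_sets.
Set Implicit Arguments.
Unset Strict Implicit.
Unset Printing Implicit Defensive.
Import Order.TTheory GRing.Theory Num.Theory.
Local Open Scope classical_set_scope.
Local Open Scope ring_scope.

(** The group [G] enters only through its root datum with respect to a maximal
    torus [T]; simply connected simple complex groups correspond to reduced,
    irreducible, simply connected root data.

    A Z-basis of the cocharacter lattice X_*(T) and the dual basis of the
    character lattice X^*(T) are fixed: characters are integer rows,
    cocharacters are integer columns, and the perfect pairing is the matrix
    product.  A root and its coroot share the same index. *)

Definition pairing n (chi : 'rV[int]_n) (lam : 'cV[int]_n) : int :=
  (chi *m lam) 0 0.

Record root_datum := RootDatum {
  rank : nat;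
  root_index :> finType;
  root_of : root_index -> 'rV[int]_rank;
  coroot_of : root_index -> 'cV[int]_rank;
  root_inj : injective root_of;
  coroot_inj : injective coroot_of;
  pairing_root_coroot : forall i, pairing (root_of i) (coroot_of i) = 2;
  root_reflection : forall i j, exists k,
    root_of j - pairing (root_of j) (coroot_of i) *: root_of i = root_of k;
  coroot_reflection : forall i j, exists k,
    coroot_of j - pairing (root_of i) (coroot_of j) *: coroot_of i = coroot_of k
}.

Arguments root_of {r} i.
Arguments coroot_of {r} i.

Definition reduced (D : root_datum) : Prop :=
  forall i j : D, root_of j <> 2 *: root_of i.

Definition irreducible (D : root_datum) : Prop :=
  (0 < #|D|)%N /\
  forall A : {set D},
    (forall i j, i \in A -> j \notin A ->
       pairing (root_of i) (coroot_of j) = 0 /\ pairing (root_of j) (coroot_of i) = 0) ->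
    A = finset.set0 \/ A = finset.setT.

(** [G] is simply connected when the coroots generate X_*(T). *)
Definition simply_connected (D : root_datum) : Prop :=
  forall v : 'cV[int]_(rank D),
    exists c : D -> int, v = \sum_(i : D) c i *: coroot_of i.

Definition nneg_comb (D : root_datum) (Delta : {set D})
    (v : 'cV[int]_(rank D)) : Prop :=
  exists c : D -> nat, v = \sum_(j in Delta) coroot_of j *+ c j.

(** The simple coroots are those with index in [Delta]. *)
Definition is_base (D : root_datum) (Delta : {set D}) : Prop :=
  (forall c : D -> int, \sum_(j in Delta) c j *: coroot_of j = 0 ->
     forall j, j \in Delta -> c j = 0) /\
  (forall i : D, nneg_comb Delta (coroot_of i) \/ nneg_comb Delta (- coroot_of i)).

Definition pos_coroots (D : root_datum) (Delta : {set D}) :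
    set 'cV[int]_(rank D) :=
  [set v | (exists i : D, v = coroot_of i) /\ nneg_comb Delta v].

(** The matrix of [lam |-> lam - <root_of i, lam> coroot_of i]. *)
Definition reflection (D : root_datum) (i : D) : 'M[int]_(rank D) :=
  1 - coroot_of i *m root_of i.

(** Reflections are involutions, so the subgroup of GL(X_*(T)) they generate
    consists of their products. *)
Definition weyl_group (D : root_datum) : set 'M[int]_(rank D) :=
  [set w | exists s : seq D, w = \prod_(i <- s) reflection i].

Definition has_word (D : root_datum) (Delta : {set D}) (w : 'M[int]_(rank D))
    (k : nat) : bool :=
  [exists t : k.-tuple D,
     all (mem Delta) t && (w == \prod_(i <- t) reflection i)].

(** The value 0 in the second case is never taken on the Weyl group, which is
    generated by the simple reflections. *)
Definition coxeter_length (D : root_datum) (Delta : {set D})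
    (w : 'M[int]_(rank D)) : nat :=
  if pselect (exists k, has_word Delta w k) is left ex then ex_minn ex else 0%N.

(** Sets of coroots are given by the indices of their elements. *)
Definition inversions (D : root_datum) (Delta : {set D})
    (w : 'M[int]_(rank D)) : set D :=
  [set i | pos_coroots Delta (coroot_of i) /\
           pos_coroots Delta (- (w *m coroot_of i))].

Definition rat_vec n (v : 'cV[int]_n) : 'cV[rat]_n := map_mx intr v.

Definition decomposable (D : root_datum) (Delta : {set D})
    (w : 'M[int]_(rank D)) (eta : D) : Prop :=
  exists (mu mu' : D) (c : nat),
    [/\ inversions Delta w mu, inversions Delta w mu', mu <> mu', (0 < c)%N &
        rat_vec (coroot_of eta) = c%:R^-1 *: rat_vec (coroot_of mu + coroot_of mu')].

Definition bruhat_inversions (D : root_datum) (Delta : {set D})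
    (w : 'M[int]_(rank D)) : set D :=
  [set eta | inversions Delta w eta /\
     (coxeter_length Delta (w * reflection eta))%:Z
       = (coxeter_length Delta w)%:Z - 1].

(* Main.v *)
Require Import Defs.
From HB Require Import structures.
From mathcomp Require Import all_boot all_order all_algebra.
From mathcomp Require Import boolp classical_sets.
From mathcomp Require Import zify ring.
Set Implicit Arguments.
Unset Strict Implicit.
Unset Printing Implicit Defensive.
Import Order.TTheory GRing.Theory Num.Theory.
Local Open Scope classical_set_scope.
Local Open Scope ring_scope.

(** Write N(w) for the set of inversions of w, s for the reflection in a coroot
    eta of N(w), and sigma for the involution -s of the coroots.  The proof
    rests on the count
      #|N(w)| = #|N(w s)| + #|{a in N(w) | sigma a in N(w)}|
    ([card_inversions_reflection]).  To see it, split the inversions a of w and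
    of w s according to the sign of s a.  Where s a is positive, a |-> s a
    matches those of w with those of w s.  Where s a is negative,
    a + sigma a = a - s a is a positive multiple of eta, which w makes
    negative; so w a and w (sigma a) are not both positive, every inversion of
    w s of this kind is one of w, and the inversions of w that are left over
    are the a with both a and sigma a in N(w).

    Since the length of w is #|N(w)| ([coxeter_length_card]) and
    sigma eta = eta, the length drops by exactly one iff eta is the only a in
    N(w) with sigma a in N(w).  The existence of another one is
    decomposability ([decomposable_paired]).  If a is one, then
    a + sigma a = k eta with k = <eta, a> > 0 (the root of eta paired with a)
    is a decomposition.  Conversely, let c eta = mu + mu'.  Pairing with the
    root of eta gives <eta, mu> + <eta, mu'> = 2 c, so one of the two terms,
    say <eta, mu>, is at least c, and then
    sigma mu = mu' + (<eta, mu> - c) eta is again in N(w).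

    The equality of length and number of inversions is the classical argument:
    a simple reflection changes the number of inversions by one, the exchange
    property ([exchange]) shortens words, and simple reflections generate the
    Weyl group ([reflection_simple_word]).  It needs that w maps the root
    attached to a coroot b to the root attached to w b, and that proportional
    coroots are equal up to sign.  Both follow from [root_determined]: because
    the coroots span the lattice and are finite in number, a coroot determines
    its root. *)

(** * Integer pairings *)

Lemma mem_preimset (aT rT : finType) (f : aT -> rT) (A : {set rT}) x :
  (x \in (f @^-1: A)%SET) = (f x \in A).
Proof. by rewrite inE. Qed.

Section Pairing.
Variable n : nat.
Implicit Types (r s : 'rV[int]_n) (u v : 'cV[int]_n) (a : int).

Lemma pairingDr r u v : pairing r (u + v) = pairing r u + pairing r v.
Proof. by rewrite /pairing mulmxDr mxE. Qed.

Lemma pairingZr r a v : pairing r (a *: v) = a * pairing r v.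
Proof. by rewrite /pairing -scalemxAr mxE. Qed.

Lemma pairingNr r v : pairing r (- v) = - pairing r v.
Proof. by rewrite /pairing mulmxN mxE. Qed.

Lemma pairingBl r s v : pairing (r - s) v = pairing r v - pairing s v.
Proof. by rewrite /pairing mulmxBl !mxE. Qed.

Lemma pairingZl r a v : pairing (a *: r) v = a * pairing r v.
Proof. by rewrite /pairing -scalemxAl mxE. Qed.

Lemma pairing_mulmx r (w : 'M[int]_n) v : pairing (r *m w) v = pairing r (w *m v).
Proof. by rewrite /pairing mulmxA. Qed.

Lemma eq_mulmx_cV (A B : 'M[int]_n) :
  (forall v, A *m v = B *m v) -> A = B.
Proof.
move=> AB; apply/matrixP => a b.
by have := AB (delta_mx b 0); rewrite -!colE => /colP /(_ a); rewrite !mxE.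
Qed.

Lemma scale2_inj u v : 2 *: u = 2 *: v -> u = v.
Proof.
by move=> /colP uv; apply/colP => a; have := uv a; rewrite !mxE => /mulfI; apply.
Qed.

End Pairing.

(** * Reflections, and the root attached to a coroot *)

Section RootDatum.
Variable D : root_datum.
Implicit Types (i j k : D) (v : 'cV[int]_(rank D)) (w : 'M[int]_(rank D)).

Lemma reflectionE i v :
  reflection i *m v = v - pairing (root_of i) v *: coroot_of i.
Proof.
rewrite /reflection mulmxBl mul1mx -mulmxA; congr (_ - _).
by rewrite [root_of i *m v]mx11_scalar mul_mx_scalar.
Qed.

Lemma reflection_coroot i : reflection i *m coroot_of i = - coroot_of i.
Proof. by rewrite reflectionE pairing_root_coroot scaler_nat mulr2n opprD addNKr. Qed.

Lemma reflectionK i v : reflection i *m (reflection i *m v) = v.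
Proof.
rewrite [X in _ *m X]reflectionE mulmxBr -scalemxAr reflection_coroot.
by rewrite reflectionE scalerN opprK subrK.
Qed.

Lemma reflection_sq i : reflection i * reflection i = 1.
Proof.
by apply: eq_mulmx_cV => v; rewrite mul1mx -mulmxE -mulmxA reflectionK.
Qed.

Lemma coroot_neq0 i : coroot_of i != 0.
Proof.
apply/eqP => c0; have := pairing_root_coroot i.
by rewrite c0 /pairing mulmx0 mxE.
Qed.

Lemma coroot_opp i : exists k, coroot_of k = - coroot_of i.
Proof.
have [k] := coroot_reflection i i; rewrite -reflectionE reflection_coroot => ->.
by exists k.
Qed.

Lemma coroot_scale_inj i a b : a *: coroot_of i = b *: coroot_of i -> a = b.
Proof.
move=> /(congr1 (pairing (root_of i))).
by rewrite !pairingZr pairing_root_coroot => /mulIf; apply.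
Qed.

Section Coroots_span.
Hypothesis Dsc : simply_connected D.

(** Compose the reflection of the datum in the coroot of i with the one defined
    by r.  The result is the unipotent map x |-> x + f(x) (coroot of i) with
    f = r - root_of i, and f vanishes on the coroot of i.  Its powers preserve
    the finite set of coroots, which forces f = 0. *)
Lemma root_determined (r : 'rV[int]_(rank D)) i :
    pairing r (coroot_of i) = 2 ->
    (forall j, exists k,
       coroot_of j - pairing r (coroot_of j) *: coroot_of i = coroot_of k) ->
  r = root_of i.
Proof.
move=> r2 rstab.
have transv j m : exists k, coroot_of k =
    coroot_of j + (m%:Z * pairing (r - root_of i) (coroot_of j)) *: coroot_of i.
  elim: m => [|m [k ck]]; first by exists j; rewrite mul0r scale0r addr0.
  have [k1 ck1] := rstab k; have [k2 ck2] := coroot_reflection i k1.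
  exists k2; rewrite -ck2 -ck1 ck.
  rewrite !(pairingDr, pairingNr, pairingZr, pairingBl) r2 pairing_root_coroot.
  by apply/colP => a; rewrite !mxE; ring.
have eq_coroot j : pairing (r - root_of i) (coroot_of j) = 0.
  apply/eqP/negPn/negP => nz.
  pose g (m : 'I_#|D|.+1) := sval (cid (transv j m)).
  have gE m : coroot_of (g m) = _ := svalP (cid (transv j m)).
  have g_inj : injective g.
    move=> m1 m2 /(congr1 coroot_of); rewrite !gE => /addrI /coroot_scale_inj.
    by move=> /(mulIf nz) [] /val_inj.
  by have := leq_card g g_inj; rewrite card_ord ltnn.
suff eq0 v : pairing (r - root_of i) v = 0.
  apply/eqP; rewrite -subr_eq0; apply/eqP/rowP => b.
  by have := eq0 (delta_mx b 0); rewrite /pairing -colE !mxE.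
have [c ->] := Dsc v.
rewrite /pairing mulmx_sumr summxE big1 // => j _.
by have := eq_coroot j; rewrite -scalemxAr mxE /pairing => ->; rewrite mulr0.
Qed.

(** The index k records only where the reflection sends the coroot of i; that it
    also sends the root of i to the root of k is [root_determined]. *)
Lemma reflection_conj j i k :
  reflection j *m coroot_of i = coroot_of k ->
  reflection j * reflection i = reflection k * reflection j.
Proof.
move=> ck.
have rE : root_of k *m reflection j = root_of i.
  apply: root_determined; first by rewrite pairing_mulmx ck pairing_root_coroot.
  move=> l; have [l1 cl1] := coroot_reflection j l.
  have [l2 cl2] := coroot_reflection k l1; have [l3 cl3] := coroot_reflection j l2.
  (* The candidate reflection is the conjugate of the reflection in k by the
     one in j, hence a composite of three permutations of the coroots. *)
  exists l3; rewrite -cl3 -reflectionE -cl2 -reflectionE -cl1 -reflectionE.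
  rewrite [reflection k *m _]reflectionE [in RHS]mulmxBr reflectionK -scalemxAr -ck reflectionK.
  by rewrite -pairing_mulmx.
move: (reflection j) ck rE => s ck rE.
by rewrite /reflection mulrBr mulrBl mul1r mulr1 -rE -!mulmxE !mulmxA ck.
Qed.

Lemma reflection_opp i k : coroot_of k = - coroot_of i -> reflection k = reflection i.
Proof.
rewrite -reflection_coroot => /esym /reflection_conj /(congr1 ( *%R^~ (reflection i))).
by rewrite -!mulrA !reflection_sq !mulr1.
Qed.

Section Reduced.
Hypothesis Dred : reduced D.

(** Reducedness is assumed of the roots; [root_determined] transfers it to the
    coroots, since doubling a coroot means halving its root. *)
Lemma coroot_neq_double i j : coroot_of j <> 2 *: coroot_of i.
Proof.
move=> cj; apply: (@Dred j i); symmetry; apply: root_determined.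
  by rewrite pairingZl -pairingZr -cj pairing_root_coroot.
move=> l; have [k ck] := coroot_reflection j l; exists k.
by rewrite -ck cj scalerA pairingZl [_ * 2]mulrC.
Qed.

(** Crystallographic integrality leaves few ratios: pairing the hypothesis with
    the root of j gives 4 = a <root of j, coroot of i>, so a is 1, 2 or 4, and
    the ratios 1/2 and 2 contradict reducedness.  The factor 2 accommodates the
    relation a = <root of i, coroot of j>, which arises when the reflection in i
    negates the coroot of j. *)
Lemma coroot_proportional i j a :
  0 < a -> 2 *: coroot_of j = a *: coroot_of i -> i = j.
Proof.
move=> a_gt0 ca; have := congr1 (pairing (root_of j)) ca.
rewrite !pairingZr pairing_root_coroot; set b := pairing _ _ => ab.
have b_gt0 : 0 < b by rewrite -(pmulr_rgt0 _ a_gt0) -ab.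
have {ab b_gt0} : [\/ a = 1, a = 2 | a = 4].
  have a_le4 : a <= 4.
    by rewrite (_ : 4 = a * b) ?ler_peMr ?(ltW a_gt0) // -ab.
  have : a \in [:: 1; 2; 3; 4] by rewrite !inE; lia.
  rewrite !inE => /or4P[] /eqP a_val; [exact: Or31|exact: Or32|lia|exact: Or33].
case=> a_val; move: ca; rewrite a_val.
- by rewrite scale1r => /esym /coroot_neq_double.
- by move=> /scale2_inj /coroot_inj.
- rewrite (_ : 4 = 2 * 2) // -scalerA => /scale2_inj /coroot_neq_double //.
Qed.

(** * Positive coroots *)

(** The only property of Weyl group elements used in counting inversions. *)
Definition permutes_coroots w :=
  forall i, exists k, w *m coroot_of i = coroot_of k.

Lemma permutes1 : permutes_coroots 1.
Proof. by move=> i; exists i; rewrite mul1mx. Qed.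

Lemma permutes_reflection i : permutes_coroots (reflection i).
Proof.
by move=> j; have [k ck] := coroot_reflection i j; exists k; rewrite reflectionE.
Qed.

Lemma permutesM w w' :
  permutes_coroots w -> permutes_coroots w' -> permutes_coroots (w * w').
Proof.
move=> pw pw' i; have [k ck] := pw' i; have [l cl] := pw k.
by exists l; rewrite -mulmxE -mulmxA ck.
Qed.

Lemma permutes_prod (s : seq D) : permutes_coroots (\prod_(i <- s) reflection i).
Proof.
elim: s => [|i s IH]; first by rewrite big_nil; exact: permutes1.
by rewrite big_cons; apply: permutesM; first exact: permutes_reflection.
Qed.

Lemma weyl_permutes w : weyl_group w -> permutes_coroots w.
Proof. by move=> [s ->]; exact: permutes_prod. Qed.

Section Base.
Variable Delta : {set D}.
Hypothesis Dbase : is_base Delta.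
Notation pos := (nneg_comb Delta).

Lemma nneg_combD u v : pos u -> pos v -> pos (u + v).
Proof.
move=> [a ->] [b ->]; exists (fun j => a j + b j)%N.
by rewrite -big_split; apply: eq_bigr => j _; rewrite mulrnDr.
Qed.

Lemma nneg_combMn v n : pos v -> pos (v *+ n).
Proof.
move=> [a ->]; exists (fun j => a j * n)%N.
by rewrite -sumrMnl; apply: eq_bigr => j _; rewrite mulrnA.
Qed.

Lemma nneg_combZ (a : int) v : 0 <= a -> pos v -> pos (a *: v).
Proof. by case: a => // n _ v_pos; rewrite -natz scaler_nat; exact: nneg_combMn. Qed.

(** By independence of the simple coroots, the coefficients of v and of -v,
    which are nonnegative and sum to zero, all vanish. *)
Lemma nneg_comb_salient v : pos v -> pos (- v) -> v = 0.
Proof.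
move=> [a va] [b vb].
have indep j : j \in Delta -> (a j + b j)%:Z = 0.
  move: j; apply: Dbase.1; rewrite -[RHS](subrr v) {1}va vb -big_split.
  by apply: eq_bigr => k _; rewrite -natz scaler_nat mulrnDr.
rewrite va big1 // => j /indep /eqP.
by rewrite eqz_nat addn_eq0 => /andP[/eqP-> _].
Qed.

Lemma coroot_pos_neg i : pos (coroot_of i) -> ~ pos (- coroot_of i).
Proof.
by move=> i_pos /(nneg_comb_salient i_pos) /eqP; rewrite (negPf (coroot_neq0 i)).
Qed.

Lemma simple_pos i : i \in Delta -> pos (coroot_of i).
Proof.
move=> iD; exists (fun j => (j == i) : nat).
rewrite (bigD1 i) //= eqxx mulr1n big1 ?addr0 // => j /andP[_ /negPf ->].
by rewrite mulr0n.
Qed.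

(** The reflection changes only the coefficient at i.  If the image were
    negative, the coroot of j would have no other nonzero coefficient and be a
    multiple of the coroot of i. *)
Lemma simple_reflection_pos i j :
  i \in Delta -> pos (coroot_of j) -> j <> i -> pos (reflection i *m coroot_of j).
Proof.
move=> iD [a cj] ji; have [k ck] := permutes_reflection i j.
rewrite ck; case: (Dbase.2 k) => // -[b]; rewrite -ck => cjn.
(* Here a and b are the coefficients of the coroot of j and of the opposite of
   its image. *)
have indep l : l \in Delta ->
    (a l + b l)%:Z - (l == i)%:Z * pairing (root_of i) (coroot_of j) = 0.
  move: l; apply: Dbase.1; rewrite -[RHS](subrr (reflection i *m coroot_of j)).
  rewrite cjn reflectionE {2}cj addrAC -big_split /=.
  under eq_bigr do rewrite scalerBl.
  rewrite sumrB; congr (_ - _).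
    by apply: eq_bigr => l _; rewrite -natz scaler_nat mulrnDr.
  rewrite (bigD1 i) //= eqxx mul1r big1 ?addr0 // => l /andP[_ /negPf ->].
  by rewrite mul0r scale0r.
have cjE : coroot_of j = (a i)%:Z *: coroot_of i.
  rewrite cj (bigD1 i) //= big1 ?addr0 -?natz ?scaler_nat // => l /andP[lD li].
  have := indep l lD; rewrite (negPf li) mul0r subr0 => /eqP.
  by rewrite eqz_nat addn_eq0 => /andP[/eqP-> _].
case: ji; symmetry; apply: (@coroot_proportional _ _ (2 * (a i)%:Z)).
  rewrite pmulr_rgt0 // ltz_nat lt0n; apply/eqP => a0.
  by have := coroot_neq0 j; rewrite cjE a0 scale0r eqxx.
by rewrite cjE scalerA.
Qed.

(** * Counting inversions *)

Lemma inversionsP w i : permutes_coroots w ->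
  inversions Delta w i <-> pos (coroot_of i) /\ pos (- (w *m coroot_of i)).
Proof.
move=> pw; split=> [[[_ ?] [_ ?]] //|[i_pos wi_neg]].
split; split=> //; first by exists i.
by have [k ->] := pw i; have [l <-] := coroot_opp k; exists l.
Qed.

Definition inversion_set w : {set D} :=
  finset.finset (fun i => `[< inversions Delta w i >]).

Lemma inversion_setP w i : permutes_coroots w ->
  reflect (pos (coroot_of i) /\ pos (- (w *m coroot_of i))) (i \in inversion_set w).
Proof.
move=> pw; rewrite inE; apply: (iffP idP) => [/asboolP|]; first by move/inversionsP; apply.
by move=> ?; apply/asboolP/inversionsP.
Qed.

Lemma opp_reflection_exists eta i :
  exists k, coroot_of k = - (reflection eta *m coroot_of i).
Proof. by have [k ->] := permutes_reflection eta i; exact: coroot_opp. Qed.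

(** The involution sigma = - (reflection in eta), on indices.  It fixes eta and
    preserves the set of positive coroots that the reflection makes negative. *)
Definition opp_reflection eta i : D := sval (cid (opp_reflection_exists eta i)).

Lemma coroot_opp_reflection eta i :
  coroot_of (opp_reflection eta i) = - (reflection eta *m coroot_of i).
Proof. exact: svalP (cid (opp_reflection_exists eta i)). Qed.

Lemma opp_reflection_id eta : opp_reflection eta eta = eta.
Proof. by apply: coroot_inj; rewrite coroot_opp_reflection reflection_coroot opprK. Qed.

Definition paired_inversions w eta : {set D} :=
  (inversion_set w :&: opp_reflection eta @^-1: inversion_set w)%SET.

(** Otherwise the opposite of the coroot of i would be the sum of two nonnegative
    combinations. *)
Lemma pairing_gt0 eta i :
    pos (coroot_of eta) -> pos (coroot_of i) ->
    pos (- (reflection eta *m coroot_of i)) ->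
  0 < pairing (root_of eta) (coroot_of i).
Proof.
rewrite reflectionE opprB => eta_pos i_pos si_neg; rewrite ltNge; apply/negP => k_le0.
apply: (coroot_pos_neg i_pos).
rewrite -[- _](addKr (pairing (root_of eta) (coroot_of i) *: coroot_of eta)).
by rewrite -scaleNr; apply: nneg_combD => //; apply: nneg_combZ => //; rewrite oppr_ge0.
Qed.

(** Inversions whose reflected coroot is positive cancel in the comparison.  For
    the others, w cannot make a and sigma a both positive, because their sum is
    a positive multiple of eta. *)
Lemma card_inversions_reflection w eta :
    permutes_coroots w -> eta \in inversion_set w ->
  #|inversion_set w| =
    (#|inversion_set (w * reflection eta)| + #|paired_inversions w eta|)%N.
Proof.
move=> pw etaN; have [eta_pos weta_neg] := inversion_setP eta pw etaN.
have pws := permutesM pw (permutes_reflection eta).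
pose tau i : D := sval (cid (permutes_reflection eta i)).
have tauE i : reflection eta *m coroot_of i = coroot_of (tau i).
  exact: svalP (cid (permutes_reflection eta i)).
have tauK : involutive tau.
  by move=> i; apply: coroot_inj; rewrite -!tauE reflectionK.
pose P := finset.finset (fun i => `[< pos (coroot_of i) >]).
have wneg k : (pos (- (w *m coroot_of k))) <-> ~ pos (w *m coroot_of k).
  have [l ->] := pw k; split=> [ln lp|]; first exact: coroot_pos_neg lp ln.
  by case: (Dbase.2 l).
(* First split by the sign of the reflected coroot; on the positive part, tau
   is a bijection between the inversions of w and those of w * reflection. *)
rewrite -[LHS](cardsID (tau @^-1: P)).
rewrite -(cardsID (tau @^-1: P) (inversion_set (w * _))) -addnA; congr (_ + _)%N.
  rewrite -(card_preimset _ (inv_inj tauK)); congr #|pred_of_set _|.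
  apply/setP => i; rewrite !inE tauK.
  apply/andP/andP => -[/asboolP /inversionsP [//|p1 p2] /asboolP p3].
    split; apply/asboolP => //; apply/inversionsP => //; split=> //.
    by rewrite -mulmxE -mulmxA tauE.
  split; apply/asboolP => //; apply/inversionsP => //; split=> //.
  by move: p2; rewrite -mulmxE -mulmxA tauE.
(* On the negative part, the inversions of w * reflection are among those of w,
   and the complement is the set of paired inversions. *)
rewrite -(cardsID (inversion_set (w * reflection eta)) (_ :\: _)).
have neg_tau i : i \notin P <-> pos (- coroot_of i).
  rewrite inE; split=> [/asboolP ni|ni]; first by case: (Dbase.2 i).
  by apply/asboolP => p; exact: coroot_pos_neg p ni.
congr (_ + _)%N; congr #|pred_of_set _|; apply/setP => i.
  rewrite finset.in_setI !finset.in_setD !mem_preimset.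
  case: (boolP (tau i \in P)) => //= /neg_tau tau_neg.
  apply/andP/idP => [[]//|iN']; split=> //.
  have [i_pos wsi_neg] := inversion_setP i pws iN'.
  apply/(inversion_setP i pw); split=> //; apply/wneg => wi_pos.
  (* If w kept the coroot of i positive, it would keep k times the coroot of
     eta positive. *)
  have k_gt0 : 0 < pairing (root_of eta) (coroot_of i).
    by apply: pairing_gt0 => //; rewrite tauE.
  have := nneg_combD wi_pos wsi_neg.
  rewrite -mulmxE -mulmxA reflectionE mulmxBr opprB addrCA subrr addr0 -scalemxAr.
  have := nneg_combZ (ltW k_gt0) weta_neg; rewrite scalerN => /nneg_comb_salient.
  rewrite opprK => H /H {H} /eqP.
  have [k ck] := pw eta.
  rewrite ck oppr_eq0 -(scale0r (coroot_of k)) => /eqP /coroot_scale_inj k0.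
  by rewrite k0 ltxx in k_gt0.
rewrite finset.in_setI !finset.in_setD !mem_preimset.
case: (boolP (i \in inversion_set w)) => iN; last by rewrite !andbF.
have [i_pos wi_neg] := inversion_setP i pw iN; rewrite andbT /=.
apply/andP/(inversion_setP _ pw); rewrite coroot_opp_reflection mulmxN opprK tauE.
  move=> [iN' /neg_tau tau_neg]; split=> //.
  have [k ck] := pw (tau i); rewrite ck.
  case: (Dbase.2 k) => //; rewrite -ck -tauE mulmxA mulmxE => neg.
  by case/negP: iN'; apply/(inversion_setP _ pws).
move=> [/neg_tau tau_neg wtau_pos]; split=> //.
apply/negP => /(inversion_setP _ pws) [_].
by rewrite -mulmxE -mulmxA tauE => /wneg.
Qed.

(** A simple reflection makes only its own coroot negative, so that coroot is the
    only paired inversion. *)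
Lemma card_inversions_simple_neg w i :
    permutes_coroots w -> i \in Delta -> pos (- (w *m coroot_of i)) ->
  #|inversion_set w| = #|inversion_set (w * reflection i)|.+1.
Proof.
move=> pw iD wi_neg.
have iN : i \in inversion_set w.
  by apply/inversion_setP => //; split=> //; exact: simple_pos.
rewrite (card_inversions_reflection pw iN).
suff -> : paired_inversions w i = [set i]%SET by rewrite cards1 addn1.
apply/setP => j; rewrite finset.in_set1 finset.in_setI mem_preimset.
apply/andP/eqP => [[/(inversion_setP _ pw)[j_pos _] ]|->]; last by rewrite opp_reflection_id.
move=> /(inversion_setP _ pw)[sj_neg _]; apply/eqP/negPn/negP => /eqP ji.
have [k ck] := permutes_reflection i j.
have := simple_reflection_pos iD j_pos ji.
by move: sj_neg; rewrite coroot_opp_reflection ck => n /coroot_pos_neg.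
Qed.

Lemma card_inversions_simple_pos w i :
    permutes_coroots w -> i \in Delta -> pos (w *m coroot_of i) ->
  #|inversion_set (w * reflection i)| = #|inversion_set w|.+1.
Proof.
move=> pw iD wi_pos.
rewrite (@card_inversions_simple_neg (w * reflection i) i) //.
- by rewrite -mulrA reflection_sq mulr1.
- exact: permutesM (permutes_reflection i).
- by rewrite -mulmxE -mulmxA reflection_coroot mulmxN opprK.
Qed.

Lemma inversion_set1 : inversion_set 1 = finset.set0.
Proof.
apply/setP => i; rewrite finset.in_set0; apply/negP => /(inversion_setP _ permutes1)[].
by rewrite mul1mx; exact: coroot_pos_neg.
Qed.

(** * Length and number of inversions *)

Lemma reflection_conj_prod (s : seq D) i k :
    (\prod_(j <- s) reflection j) *m coroot_of i = coroot_of k ->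
  (\prod_(j <- s) reflection j) * reflection i
    = reflection k * \prod_(j <- s) reflection j.
Proof.
elim: s k => [|j s IH] k; first by rewrite big_nil mul1mx mul1r mulr1 => /coroot_inj ->.
rewrite big_cons -mulmxE -mulmxA !mulmxE; have [m cm] := permutes_prod s i.
by rewrite cm => /reflection_conj jm; rewrite -mulrA (IH m) // mulrA jm mulrA.
Qed.

(** Along the word, read from its right end, the coroot of i changes sign at some
    letter; just before, it equals the simple coroot of that letter.  By
    conjugation, multiplying by the reflection in i deletes this letter. *)
Lemma exchange (s : seq D) i :
    all (mem Delta) s -> i \in Delta ->
    pos (- ((\prod_(j <- s) reflection j) *m coroot_of i)) ->
  exists t : seq D, [/\ all (mem Delta) t, size s = (size t).+1 &
    \prod_(j <- t) reflection j = (\prod_(j <- s) reflection j) * reflection i].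
Proof.
elim: s => [_ iD|j s IH] /=.
  by rewrite big_nil mul1mx => /(coroot_pos_neg (simple_pos iD)).
move=> /andP[jD sD] iD; rewrite big_cons -mulmxE -mulmxA => neg.
have [k ck] := permutes_prod s i.
have [k_pos|k_neg] := Dbase.2 k; last first.
  rewrite -ck in k_neg; have [t [tD -> tE]] := IH sD iD k_neg.
  by exists (j :: t); split=> //=; [rewrite jD|rewrite big_cons tE -mulmxE mulmxA].
have kj : k = j.
  apply/eqP/negPn/negP => /eqP kj.
  have [l cl] := permutes_reflection j k.
  have := simple_reflection_pos jD k_pos kj.
  by move: neg; rewrite ck cl => n /coroot_pos_neg.
exists s; split=> //; rewrite mulmxE -mulrA (reflection_conj_prod ck) kj.
by rewrite mulrA reflection_sq mul1r.
Qed.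

Lemma card_inversions_le_size (s : seq D) : all (mem Delta) s ->
  (#|inversion_set (\prod_(j <- s) reflection j)| <= size s)%N.
Proof.
elim/last_ind: s => [|s i IH]; first by rewrite big_nil inversion_set1 cards0.
rewrite all_rcons /= => /andP[iD /IH{}IH]; rewrite size_rcons big_rcons /=.
have ps := permutes_prod s; have [k ck] := ps i.
have [k_pos|k_neg] := Dbase.2 k.
  by rewrite card_inversions_simple_pos ?ck.
rewrite -ck in k_neg; apply: leq_trans (leqW IH).
by rewrite (card_inversions_simple_neg ps iD k_neg) leqW.
Qed.

(** The word grows with its product: appending a letter either adds an inversion,
    and then the letter is kept, or removes one, and then the exchange property
    gives a shorter word. *)
Lemma reduced_word (s : seq D) : all (mem Delta) s ->
  exists t : seq D, [/\ all (mem Delta) t,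
    \prod_(j <- t) reflection j = \prod_(j <- s) reflection j &
    size t = #|inversion_set (\prod_(j <- s) reflection j)|].
Proof.
elim/last_ind: s => [|s i IH].
  by move=> _; exists [::]; split=> //; rewrite big_nil inversion_set1 cards0.
rewrite all_rcons /= => /andP[iD /IH[t [tD tE t_size]]]; rewrite big_rcons /=.
have ps := permutes_prod s; have [k ck] := ps i.
have [k_pos|k_neg] := Dbase.2 k.
  exists (rcons t i); rewrite all_rcons size_rcons big_rcons /= tE t_size.
  by rewrite iD; split=> //; rewrite card_inversions_simple_pos ?ck.
rewrite -ck in k_neg; have := k_neg; rewrite -tE => /(exchange tD iD)[u [uD tu uE]].
exists u; rewrite uE tE; split=> //; apply: succn_inj.
by rewrite -tu t_size (card_inversions_simple_neg ps iD).
Qed.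

(** Otherwise the reflection would preserve the cone of nonnegative combinations,
    but it negates the coroot of i. *)
Lemma exists_simple_descent i : pos (coroot_of i) ->
  exists2 j, j \in Delta & pos (- (reflection i *m coroot_of j)).
Proof.
move=> i_pos; apply: contrapT => none.
have [a ci] := i_pos; apply: (coroot_pos_neg i_pos).
rewrite -reflection_coroot ci mulmx_sumr.
elim/big_ind: _ => [|u v|j jD]; first by exists (fun=> 0%N); rewrite big1.
  exact: nneg_combD.
rewrite -scaler_nat -scalemxAr scaler_nat; apply: nneg_combMn.
have [k ck] := permutes_reflection i j; rewrite ck.
by case: (Dbase.2 k) => // neg; case: none; exists j; rewrite ?ck.
Qed.

(** Induction on the number of inversions of the reflection: if i is not simple,
    conjugating by a simple descent j gives a reflection with fewer
    inversions. *)
Lemma reflection_simple_word i : exists2 s : seq D,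
  all (mem Delta) s & reflection i = \prod_(j <- s) reflection j.
Proof.
wlog i_pos : i / pos (coroot_of i).
  move=> H; have [|neg] := Dbase.2 i; first exact: H.
  have [k ck] := coroot_opp i; rewrite -(reflection_opp ck).
  by apply: H; rewrite ck.
have [n] := ubnP #|inversion_set (reflection i)|.
elim: n i i_pos => // n IH i i_pos; rewrite ltnS => le_n.
have [j jD ij_neg] := exists_simple_descent i_pos.
have [->|ji] := eqVneq i j; first by exists [:: j]; rewrite /= ?jD ?big_seq1.
have [k ck] := permutes_reflection j i.
have k_pos : pos (coroot_of k) by rewrite -ck; apply: simple_reflection_pos => //; exact/eqP.
have kE : reflection k = reflection j * reflection i * reflection j.
  by rewrite (reflection_conj ck) -mulrA reflection_sq mulr1.
have lt_k : (#|inversion_set (reflection k)| < #|inversion_set (reflection i)|)%N.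
  have pi := permutes_reflection i; have pj := permutes_reflection j.
  have pij := permutesM pi pj.
  rewrite (card_inversions_simple_neg pi jD ij_neg) ltnS; apply/subset_leq_card/fintype.subsetP => l.
  move=> /(inversion_setP _ (permutes_reflection k))[l_pos kl_neg].
  apply/(inversion_setP _ pij); split=> //.
  have [m cm] := pij l; case: (Dbase.2 m); rewrite -cm // => m_pos.
  rewrite cm in m_pos.
  (* An inversion l of reflection k = reflection j * (reflection i *
     reflection j) that is not an inversion of the second factor would be sent
     by it to the coroot of j, the only positive one that reflection j makes
     negative.  Then l is the opposite of the image under j of the positive
     coroot g = - (reflection i)(coroot of j), which is a negative coroot unless
     g = j; and g = j makes the coroots of i and j proportional. *)
  have kl : reflection k *m coroot_of l = reflection j *m coroot_of m.
    by rewrite kE -cm -!mulmxE !mulmxA.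
  have mj : m = j.
    apply/eqP/negPn/negP => /eqP mj.
    have [l' cl'] := permutes_reflection k l.
    have := simple_reflection_pos jD m_pos mj.
    by move: kl_neg; rewrite -kl cl' => neg /coroot_pos_neg.
  have [g cg] := opp_reflection_exists i j.
  have g_pos : pos (coroot_of g) by rewrite cg.
  have cl : coroot_of l = - (reflection j *m coroot_of g).
    rewrite cg mulmxN opprK; move: cm; rewrite mj => <-; rewrite -mulmxE.
    by rewrite -!mulmxA !reflectionK.
  have gj : g <> j.
    move=> gj; move: cg; rewrite gj reflectionE opprB => cj.
    case/eqP: ji; apply: (coroot_proportional
                            (a := pairing (root_of i) (coroot_of j))).
      exact: pairing_gt0 (simple_pos jD) ij_neg.
    by rewrite scaler_nat mulr2n {1}cj subrK.
  case: (coroot_pos_neg l_pos); rewrite cl opprK.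
  exact: simple_reflection_pos.
have [s sD sE] := IH k k_pos (leq_trans lt_k le_n).
exists (j :: rcons s j); first by rewrite /= all_rcons /= jD.
rewrite big_cons big_rcons /= -sE kE !mulrA reflection_sq mul1r.
by rewrite -mulrA reflection_sq mulr1.
Qed.

Lemma weyl_simple_word w : weyl_group w -> exists2 s : seq D,
  all (mem Delta) s & w = \prod_(j <- s) reflection j.
Proof.
move=> [t ->]; elim: t => [|i t [s sD sE]]; first by exists [::]; rewrite ?big_nil.
have [u uD uE] := reflection_simple_word i.
by exists (u ++ s); rewrite ?all_cat ?uD // big_cons big_cat /= -uE -sE.
Qed.

Lemma coxeter_length_card w : weyl_group w ->
  coxeter_length Delta w = #|inversion_set w|.
Proof.
move=> /weyl_simple_word[s sD wE].
have word : has_word Delta w #|inversion_set w|.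
  have [t [tD tE t_size]] := reduced_word sD; apply/existsP.
  rewrite -wE in tE t_size.
  by exists (Tuple (introT eqP t_size)); rewrite /= tD tE eqxx.
rewrite /coxeter_length; case: pselect => [ex|]; last by case; exists #|inversion_set w|.
case: ex_minnP => m /existsP[t /andP[tD /eqP wtE]] m_min.
apply/eqP; rewrite eqn_leq m_min //= -(size_tuple t) wtE.
exact: card_inversions_le_size.
Qed.

Lemma weyl_mul_reflection w i : weyl_group w -> weyl_group (w * reflection i).
Proof. by move=> [s ->]; exists (rcons s i); rewrite big_rcons. Qed.

(** * Decomposability *)

Lemma decomposableP w eta : decomposable Delta w eta <->
  exists mu mu' (c : nat), [/\ inversions Delta w mu, inversions Delta w mu',
    mu <> mu', (0 < c)%N & coroot_of eta *+ c = coroot_of mu + coroot_of mu'].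
Proof.
have clear_denom (c : nat) (u v : 'cV[int]_(rank D)) : (0 < c)%N ->
    rat_vec u = c%:R^-1 *: rat_vec v <-> u *+ c = v.
  move=> c_gt0; have c_neq0 : c%:R != 0 :> rat by rewrite pnatr_eq0 -lt0n.
  split=> [/colP uv|<-].
    apply/colP => a; have := uv a; rewrite !mxE => /(congr1 ( *%R c%:R)).
    rewrite mulVKf // -[c%:R]/(c%:~R) -intrM mulrC => /intr_inj <-.
    by rewrite mulmxnE -mulr_natr natz.
  by apply/colP => a; rewrite !mxE mulmxnE rmorphMn /= -[X in _ = _ * X]mulr_natl mulKf.
split=> -[mu [mu' [c [muN mu'N ne c_gt0 E]]]]; exists mu, mu', c; split=> //.
  exact/(clear_denom c _ _ c_gt0).
exact/(clear_denom c _ _ c_gt0).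
Qed.

(** A pair {i, sigma i} of inversions sums to a positive multiple of eta.  Given
    an arbitrary decomposition mu + mu' of c eta, the summand with the larger
    pairing with the root of eta can be taken for i. *)
Lemma decomposable_paired w eta :
    permutes_coroots w -> eta \in inversion_set w ->
  decomposable Delta w eta <-> exists2 i, i <> eta & i \in paired_inversions w eta.
Proof.
move=> pw etaN; have [eta_pos weta_neg] := inversion_setP eta pw etaN.
split=> [/decomposableP[mu [mu' [c [muN mu'N ne c_gt0 E]]]]|[i i_eta]].
  (* The image sigma x is y plus a nonnegative multiple of eta. *)
  have large x y : inversions Delta w x -> inversions Delta w y -> x <> y ->
      coroot_of eta *+ c = coroot_of x + coroot_of y ->
      c%:Z <= pairing (root_of eta) (coroot_of x) ->
      exists2 i, i <> eta & i \in paired_inversions w eta.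
    move=> xN yN xy; rewrite -scaler_nat natz => exy le_c.
    have [x_pos wx_neg] := (inversionsP x pw).1 xN.
    have [y_pos wy_neg] := (inversionsP y pw).1 yN.
    exists x.
      move=> x_eta; rewrite x_eta in exy xy.
      have yE : coroot_of y = (c%:Z - 1) *: coroot_of eta.
        by rewrite scalerBl scale1r exy addrC addKr.
      apply/xy/(coroot_proportional (a := 2 * (c%:Z - 1))); last by rewrite yE scalerA.
      have [c1|] : c = 1%N \/ (1 < c)%N by lia.
        by have := coroot_neq0 y; rewrite yE c1 subrr scale0r eqxx.
      by lia.
    rewrite finset.in_setI mem_preimset; apply/andP; split.
      by apply/(inversion_setP _ pw).
    set k := pairing _ _ in le_c.
    have sxE : coroot_of (opp_reflection eta x)
        = coroot_of y + (k - c%:Z) *: coroot_of eta.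
      rewrite coroot_opp_reflection reflectionE opprB -/k scalerBl exy.
      by apply/colP => a; rewrite !mxE; ring.
    apply/(inversion_setP _ pw); rewrite sxE; split.
      by apply: nneg_combD => //; apply: nneg_combZ; rewrite ?subr_ge0.
    rewrite mulmxDr opprD -scalemxAr -scalerN.
    by apply: nneg_combD => //; apply: nneg_combZ; rewrite ?subr_ge0.
  have pairE : c%:Z * 2 = pairing (root_of eta) (coroot_of mu)
                        + pairing (root_of eta) (coroot_of mu').
    by rewrite -[c%:Z]natz -pairingDr -E -scaler_nat pairingZr pairing_root_coroot.
  have [le_c|lt_c] := leP c%:Z (pairing (root_of eta) (coroot_of mu)).
    exact: (large mu mu').
  apply: (large mu' mu) => //; [by move=> /esym|by rewrite [RHS]addrC|].
  by lia.
rewrite finset.in_setI mem_preimset.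
case/andP => /[dup] /(inversion_setP _ pw)[i_pos _] iN.
move=> /[dup] /(inversion_setP _ pw)[si_pos _] siN; move: si_pos.
rewrite coroot_opp_reflection => si_neg.
have k_gt0 := pairing_gt0 eta_pos i_pos si_neg.
apply/decomposableP; exists i, (opp_reflection eta i).
exists `|pairing (root_of eta) (coroot_of i)|%N.
have kE : coroot_of i + coroot_of (opp_reflection eta i)
    = pairing (root_of eta) (coroot_of i) *: coroot_of eta.
  by rewrite coroot_opp_reflection reflectionE opprB addrCA subrr addr0.
split.
- by move: iN; rewrite inE => /asboolP.
- by move: siN; rewrite inE => /asboolP.
- move=> si; apply: i_eta; symmetry; apply: (coroot_proportional k_gt0).
  by rewrite -kE -si scaler_nat mulr2n.
- by rewrite absz_gt0 gt_eqF.
- by rewrite kE -scaler_nat natz gtz0_abs.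
Qed.

(** By the count above, the length drops by the number of paired inversions, of
    which eta itself is one. *)
Lemma length_reflectionP w eta : weyl_group w -> inversions Delta w eta ->
  (coxeter_length Delta (w * reflection eta))%:Z = (coxeter_length Delta w)%:Z - 1
  <-> ~ decomposable Delta w eta.
Proof.
move=> wW etaN.
have pw := weyl_permutes wW.
have {}etaN : eta \in inversion_set w by rewrite inE; apply/asboolP.
have eta_paired : eta \in paired_inversions w eta.
  by rewrite finset.in_setI mem_preimset opp_reflection_id etaN.
rewrite !coxeter_length_card //; last exact: weyl_mul_reflection.
rewrite (card_inversions_reflection pw etaN) (cardsD1 eta (paired_inversions w eta)) eta_paired.
rewrite (decomposable_paired pw etaN); split=> [cardE [i /eqP i_eta iP]|none].
  have : i \in (paired_inversions w eta :\ eta)%SET by rewrite in_setD1 i_eta.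
  suff /cards0_eq -> : #|(paired_inversions w eta :\ eta)%SET| = 0%N by rewrite finset.in_set0.
  by move: cardE; rewrite /=; lia.
suff -> : (paired_inversions w eta :\ eta)%SET = finset.set0.
  by rewrite cards0 /=; lia.
apply/setP => i; rewrite in_setD1 finset.in_set0; apply/andP => -[/eqP i_eta iP].
by apply: none; exists i.
Qed.

End Base.
End Reduced.
End Coroots_span.
End RootDatum.

Theorem proposition3p4 (D : root_datum)
    (Dred : reduced D) (Dirr : irreducible D) (Dsc : simply_connected D)
    (Delta : {set D}) (Dbase : is_base Delta)
    (w : 'M[int]_(rank D)) (wW : weyl_group w) :
  (forall eta : D, inversions Delta w eta ->
     ((coxeter_length Delta (w * reflection eta))%:Z
        = (coxeter_length Delta w)%:Z - 1
      <-> ~ decomposable Delta w eta)) /\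
  bruhat_inversions Delta w
    = [set eta | inversions Delta w eta /\ ~ decomposable Delta w eta].
Proof.
have lengthP eta := @length_reflectionP D Dsc Dred Delta Dbase w eta wW.
split=> //; apply/seteqP; split=> eta [etaN H]; by split=> //; apply/(lengthP eta etaN).
Qed.
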